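(* Let $r\ge 1$, and let $C$ be an $(r+1)$-partite semiregular $r$-complex with respect to a partition $V=V_0\sqcup\cdots\sqcup V_r$ of a finite set $V$ into nonempty parts, with corresponding degrees $d_0,\ldots,d_r$. If $C^+\in\mathcal{F}_r^+(C)$, then $$\lambda_{\max}\bigl(L^{\mathrm{up}}_{r-1}(C^+)\bigr)=\max_{F\in S_r(C^+)}\Bigl|\bigcup_{E\in\partial F}N_{C^+}(E)\Bigr|=d_0+\cdots+d_r .$$ In particular, every complex $K\in\mathcal{F}_r^+$ satisfies $$\lambda_{\max}\bigl(L^{\mathrm{up}}_{r-1}(K)\bigr)=\max_{F\in S_r(K)}\Bigl|\bigcup_{E\in\partial F}N_K(E)\Bigr| .$$
   Context: A finite (abstract) simplicial complex is a collection of finite sets closed under inclusion; an $r$-face is a face of cardinality $r+1$; $S_r(K)$ is the set of $r$-faces of $K$; $V(K)$ is the vertex set; an $r$-complex is a complex of dimension $r$ (the maximum dimension of its faces). It is pure if every face is contained in an $r$-face. Laplacian: choose an orientation (an ordering of the vertices up to even permutation) for each face, written $[F]$. $C_r(K,\mathbb{R})$ is the real vector space with basis $\{[F]:F\in S_r(K)\}$, with the inner product making this basis orthonormal. The boundary map $\partial_r:C_r(K,\mathbb{R})\to C_{r-1}(K,\mathbb{R})$ is $\partial_r[v_0,\ldots,v_r]=\sum_{j=0}^r(-1)^j[v_0,\ldots,\widehat{v_j},\ldots,v_r]$, and $\partial_r^*$ is its adjoint. The combinatorial $(r-1)$-up Laplacian is $L^{\mathrm{up}}_{r-1}(K)=\partial_r\partial_r^*$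 acting on $C_{r-1}(K,\mathbb{R})$; $\lambda_{\max}$ denotes its largest eigenvalue. For an $r$-face $F$, $\partial F$ denotes the set of all $(r-1)$-faces contained in $F$. For an $(r-1)$-face $E$ of $K$, $N_K(E)=\{u\in V(K)\setminus E: E\cup\{u\}\in S_r(K)\}$. Partite semiregular complexes: let $V=V_0\sqcup V_1\sqcup\cdots\sqcup V_r$ be a partition into nonempty parts. A pure $r$-complex $C$ on $V$ is $(r+1)$-partite with respect to this partition if every $r$-face of $C$ contains exactly one vertex from each part. For $0\le i\le r$ and an $r$-subset $S\subseteq V\setminus V_i$ containing exactly one vertex from each part $V_j$ with $j\ne i$, put $d_i(S)=|\{v\in V_i: S\cup\{v\}\in S_r(C)\}|$. $C$ is semiregular if for each $0\le i\le r$ there is a positive integer $d_i$ (the corresponding degree) such that $d_i(S)=d_i$ for every such set $S$. Admissible additions: let $C$ be an $(r+1)$-partite semiregular $r$-complex on $V$ and $C^+$ a pure $r$-complex on $V$ with $S_r(C)\subseteq S_r(C^+)$. The faces in $S_r(C^+)\setminus S_r(C)$ are called added faces. $C^+$ is obtained from $C$ by admissible additions if: (1) no added face contains exactly one vertex from each part; and (2) for every $F=\{x_0,\ldots,x_r\}\in S_r(C)$ with $x_i\in V_i$ for all $i$: if an added face has the form $P=(F\setminus\{x_j\})\cup\{u\}$ for some $u\in V_i$ and some $i\ne j$, then $(F\setminus\{x_i\})\cup\{u\}\in S_r(C)$. $\mathcal{F}_r^+(C)$ is the family of all pure $r$-complexes $C^+$ obtained from $C$ by admissible additions and satisfying $\bigl|\bigcup_{E\in\partial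 P}N_{C^+}(E)\bigr|\le d_0+\cdots+d_r$ for every added face $P\in S_r(C^+)\setminus S_r(C)$. $\mathcal{F}_r^+$ is the family of all pure $r$-complexes obtained in this way from some $(r+1)$-partite semiregular $r$-complex $C$ (i.e. the union of the families $\mathcal{F}_r^+(C)$ over all such $C$). *)

(* Defs.v *)
From HB Require Import structures.
From mathcomp Require Import all_boot all_order all_fingroup all_algebra.
From mathcomp Require Import reals.

Set Implicit Arguments.
Unset Strict Implicit.
Unset Printing Implicit Defensive.

Import Order.TTheory GRing.Theory Num.Theory.
Local Open Scope ring_scope.

Section Complexes.
Variable V : finType.
Implicit Types (K C : {set {set V}}) (E F G : {set V}) (r : nat).

Definition simplicial_complex K : Prop :=
  forall F G, F \in K -> G \subset F -> G \in K.

(* S_r(K): an r-face has r + 1 vertices. *)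
Definition faces K r : {set {set V}} := [set F in K | #|F| == r.+1].

Definition vertices K : {set V} := [set v | [set v] \in K].

Definition has_dimension r K : Prop :=
  (exists F, F \in faces K r) /\ (forall F, F \in K -> (#|F| <= r.+1)%N).

Definition pure_complex r K : Prop :=
  [/\ simplicial_complex K, has_dimension r K
    & forall F, F \in K -> exists2 G, G \in faces K r & F \subset G].

(* N_K(E), for an (r-1)-face E. *)
Definition nbhd r K E : {set V} :=
  [set u in vertices K :\: E | u |: E \in faces K r].

(* The set of (r-1)-faces contained in F; meant for 0 < r. *)
Definition facets r K F : {set {set V}} :=
  [set E in faces K r.-1 | E \subset F].

Definition facet_nbhd r K F : {set V} :=
  \bigcup_(E in facets r K F) nbhd r K E.

Definition max_facet_nbhd r K : nat :=
  \max_(F in faces K r) #|facet_nbhd r K F|.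

(* An orientation of a face F is represented by one of its orderings o F; the
   relation "up to even permutation" is accounted for in oriented_coef. *)
Definition orientation K (o : {set V} -> seq V) : Prop :=
  forall F, F \in K -> perm_eq (o F) (enum F).

Definition permute (s : seq V) (p : {perm 'I_(size s)}) : seq V :=
  [seq tnth (in_tuple s) (p i) | i <- enum 'I_(size s)].

Section Laplacian.
Variable R : realType.

(* For duplicate-free s: the sign of the permutation turning s into t, and 0
   if t is not a reordering of s (at most one p contributes to the sum). *)
Definition oriented_coef (s t : seq V) : R :=
  \sum_(p : {perm 'I_(size s)} | permute p == t) (-1) ^+ odd_perm p.

Variables (o : {set V} -> seq V) (K : {set {set V}}).

(* C_k(K, R) is 'rV[R]_#|faces K k|, its standard basis being the [F].
   The chain [s] of an arbitrary ordering s of a k-face is plus or minus the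
   basis vector of that face. *)
Definition oriented_simplex k (s : seq V) : 'rV[R]_#|faces K k| :=
  \row_i oriented_coef s (o (enum_val i)).

Definition delete_nth (j : nat) (s : seq V) : seq V :=
  take j s ++ drop j.+1 s.

Definition boundary_seq k (s : seq V) : 'rV[R]_#|faces K k| :=
  \sum_(j < size s) (-1) ^+ j *: oriented_simplex k (delete_nth j s).

(* The boundary map from C_(k+1) to C_k, acting on row vectors on the right. *)
Definition boundary_mx k : 'M[R]_(#|faces K k.+1|, #|faces K k|) :=
  \matrix_i boundary_seq k (o (enum_val i)).

(* The bases being orthonormal, the adjoint is the transpose. *)
Lemma boundary_mx_adjoint k (x : 'rV[R]_#|faces K k.+1|)
    (y : 'rV[R]_#|faces K k|) :
  (x *m boundary_mx k) *m y^T = x *m (y *m (boundary_mx k)^T)^T.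
Proof. by rewrite trmx_mul trmxK mulmxA. Qed.

(* The k-up Laplacian; with row vectors, the adjoint is applied first. *)
Definition up_laplacian k : 'M[R]_#|faces K k| :=
  (boundary_mx k)^T *m boundary_mx k.

End Laplacian.

Section Partite.
Variables (r : nat) (P : 'I_r.+1 -> {set V}).

Definition vertex_partition : Prop :=
  [/\ forall i, P i != set0,
      forall i j, i != j -> [disjoint P i & P j]
    & \bigcup_i P i = [set: V]].

Definition one_per_part F : Prop := forall i, #|F :&: P i| = 1%N.

Definition partite C : Prop :=
  pure_complex r C /\ (forall F, F \in faces C r -> one_per_part F).

Definition part_degree C (i : 'I_r.+1) (S : {set V}) : nat :=
  #|[set v in P i | v |: S \in faces C r]|.

Definition semiregular C (d : 'I_r.+1 -> nat) : Prop :=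
  forall i, (0 < d i)%N /\
    forall S : {set V}, #|S| = r -> S \subset ~: P i ->
      (forall j, j != i -> #|S :&: P j| = 1%N) -> part_degree C i S = d i.

Definition added_faces C Cp : {set {set V}} := faces Cp r :\: faces C r.

Definition admissible_additions C Cp : Prop :=
  [/\ pure_complex r Cp,
      faces C r \subset faces Cp r,
      forall F, F \in added_faces C Cp -> ~ one_per_part F
    & forall x : 'I_r.+1 -> V, (forall i, x i \in P i) ->
      let F := [set x i | i : 'I_r.+1] in F \in faces C r ->
      forall i j u, i != j -> u \in P i ->
        u |: (F :\ x j) \in added_faces C Cp ->
        u |: (F :\ x i) \in faces C r].

Definition Fplus_of C (d : 'I_r.+1 -> nat) Cp : Prop :=
  admissible_additions C Cp /\
  (forall F, F \in added_faces C Cp ->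
     (#|facet_nbhd r Cp F| <= \sum_(i < r.+1) d i)%N).

End Partite.

Definition Fplus r K : Prop :=
  exists (P : 'I_r.+1 -> {set V}) (C : {set {set V}}) (d : 'I_r.+1 -> nat),
    [/\ vertex_partition P, partite P C, semiregular P C d & Fplus_of P C d K].

End Complexes.

Definition is_lambda_max (R : realType) (n : nat) (M : 'M[R]_n) (a : R) : Prop :=
  eigenvalue M a /\ (forall b, eigenvalue M b -> b <= a).

(* Main.v *)
Require Import Defs.
From HB Require Import structures.
From mathcomp Require Import all_boot all_order all_fingroup all_algebra.
From mathcomp Require Import reals zify.

Set Implicit Arguments.
Unset Strict Implicit.
Unset Printing Implicit Defensive.

Import Order.TTheory GRing.Theory Num.Theory.
Local Open Scope ring_scope.

(** Write B for the boundary matrix from r-faces to (r-1)-faces, N(F) for the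
union of the neighbourhoods of the facets of F, and m for d_0 + ... + d_r.

Upper bound, valid for every complex.  The nonzero eigenvalues of B^T B are
those of B B^T, so it suffices that |h B|^2 <= max_F |N(F)| |h|^2 for every
r-chain h.  Expanding |h B|^2, the diagonal terms give (r+1) h(F)^2 for each
F.  An off-diagonal term involves two r-faces E+x and E+y, hence one set
T = E+x+y with r+2 elements, and because the boundary of a boundary vanishes
it is minus the product of the corresponding terms a_y, a_x of the coboundary
of h at T.  So T contributes (sum_x a_x^2) - (sum_x a_x)^2, which is at most
sum_x a_x^2, and contributes nothing unless T contains at least two r-faces.
In other words h(F)^2 is counted once for each u outside F such that F+u
contains a second r-face, that is, once for each u of N(F) outside F
(boundary_energy, boundary_energy_bound, facet_nbhd_card,
up_laplacian_eigenvalue_le).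

An eigenvector for m.  Map each vertex to the index of its part.  This is a
vertex map to the simplex on {0, ..., r}, and with orientations listing the
parts increasingly, the boundary of the chain h = sum of all r-faces of C is
the pull-back of the cochain taking the facet opposite to j to (-1)^j d_j, by
semiregularity.  Pulling back commutes with coboundaries, so the coboundary of
the boundary of h is sum_j (-1)^j (-1)^j d_j = m on the r-faces meeting every
part and 0 on the others, that is, on the added ones.  Hence it equals m h
(boundary_indicator_missing, coboundary_boundary_transversal,
coboundary_boundary_not_transversal).

Finally N(F) has at most m elements: by hypothesis for added faces, and for an
r-face F of C because the exchange condition on admissible additions puts
every element of N(F) that lies in part i among the d_i vertices completing
F minus x_i to an r-face of C (facet_nbhd_transversal).  Thus
m <= lambda_max <= max |N(F)| <= m. *)

(** * Orientation signs as determinants *)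

Section OrientationSign.
Variables (R : realType) (V : finType).
Implicit Types (s t u w : seq V) (n : nat).
Local Notation coef := (oriented_coef R).

(** For a reordering [t] of a duplicate-free [s], the matrix of a permutation, whose
determinant is its sign; composition of reorderings becomes matrix multiplication,
so signs multiply by [det_mulmx].
The default [x0] of [nth] is never reached when both sizes are [n]. *)
Definition match_mx x0 n t s : 'M[R]_n :=
  \matrix_(i, j) (nth x0 t i == nth x0 s j)%:R.

(** In the Leibniz formula the product attached to a permutation is 1 when this
permutation turns [s] into [t], and 0 otherwise. *)
Lemma oriented_coef_det x0 n s t : size s = n -> size t = n ->
  coef s t = \det (match_mx x0 n t s).
Proof.
move=> <- szt; rewrite /oriented_coef big_mkcond; apply: eq_bigr => p _.
have -> : (permute p == t) =
    [forall i : 'I_(size s), nth x0 t i == nth x0 s (p i)].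
  apply/eqP/forallP => [<- i | eq_ts].
    rewrite (nth_map i) ?size_enum_ord // nth_ord_enum.
    by rewrite (tnth_nth x0).
  apply: (@eq_from_nth _ x0) => [|i]; rewrite size_map size_enum_ord // => lt_i.
  rewrite (nth_map (Ordinal lt_i)) ?size_enum_ord //.
  rewrite (nth_ord_enum _ (Ordinal lt_i)) (tnth_nth x0).
  by rewrite (eqP (eq_ts (Ordinal lt_i))).
case: ifPn => [/forallP eq_ts|].
  rewrite big1 ?mulr1 // => i _; by rewrite mxE eq_ts.
rewrite negb_forall => /existsP[i /negPf neq_i].
by rewrite (bigD1 i) //= mxE neq_i mul0r mulr0.
Qed.

Lemma oriented_coef_perm s t : ~~ perm_eq s t -> coef s t = 0.
Proof.
move=> nst; apply: big1 => p /eqP def_t; case/negP: nst; rewrite -def_t.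
rewrite perm_sym /permute (map_comp (tnth (in_tuple s)) p).
rewrite -[X in perm_eq _ X](map_tnth_enum (in_tuple s)); apply: perm_map.
apply: uniq_perm; rewrite ?(map_inj_uniq (@perm_inj _ p)) ?enum_uniq // => i.
rewrite mem_enum; apply/mapP; exists ((p^-1)%g i); first by rewrite mem_enum.
by rewrite permKV.
Qed.

Lemma match_mx_mul x0 n s t u : uniq t -> size t = n -> size s = n ->
    {subset s <= t} ->
  match_mx x0 n s t *m match_mx x0 n t u = match_mx x0 n s u.
Proof.
move=> ut szt szs sub_st; apply/matrixP => i k; rewrite !mxE.
have t_si : nth x0 s i \in t by apply/sub_st/mem_nth; rewrite szs.
have lt_i : (index (nth x0 s i) t < n)%N by move: t_si; rewrite -index_mem szt.
rewrite (bigD1 (Ordinal lt_i)) //= !mxE /= nth_index // eqxx mul1r big1 ?addr0 //.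
move=> j; rewrite -val_eqE !mxE /= => neq_ji.
case: eqP => [eq_ij|]; last by rewrite mul0r.
by case/negP: neq_ji; rewrite eq_ij index_uniq ?szt.
Qed.

Lemma oriented_coef_nil : coef ([::] : seq V) [::] = 1.
Proof.
rewrite /oriented_coef (big_pred1 1%g) => [|p /=]; first by rewrite odd_perm1.
have -> : p = 1%g by apply/permP => -[].
by rewrite eqxx -size_eq0 size_map size_enum_ord.
Qed.

Lemma oriented_coef_trans s t u : uniq t -> perm_eq t u -> size s = size t ->
  coef s u = coef s t * coef t u.
Proof.
case: t => [|x0 t0].
  move=> _ /perm_size/esym/size0nil-> /size0nil->.
  by rewrite oriented_coef_nil mulr1.
set t := x0 :: t0 => ut tu szs; have szu := perm_size tu.
rewrite !(@oriented_coef_det x0 (size t)) // mulrC -det_mulmx match_mx_mul //.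
by move=> x; rewrite (perm_mem tu).
Qed.

Lemma oriented_coefC s t : size s = size t -> coef s t = coef t s.
Proof.
case: t => [/size0nil->//|x0 t0]; set t := x0 :: t0 => szs.
rewrite !(@oriented_coef_det x0 (size t)) // -det_tr; congr (\det _).
by apply/matrixP => i j; rewrite !mxE eq_sym.
Qed.

Lemma oriented_coef_id s : uniq s -> coef s s = 1.
Proof.
case: s => [|x0 s0]; first by rewrite oriented_coef_nil.
set s := x0 :: s0 => us; rewrite (@oriented_coef_det x0 (size s)) //.
rewrite -[RHS](det1 R (size s)); congr (\det _).
by apply/matrixP => i j; rewrite !mxE nth_uniq.
Qed.

Lemma oriented_coef_sqr s t : uniq s -> perm_eq s t -> coef s t * coef s t = 1.
Proof.
move=> us st; have szt := perm_size st.
rewrite {2}oriented_coefC // -oriented_coef_trans ?oriented_coef_id //.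
  by rewrite -(perm_uniq st).
by rewrite perm_sym.
Qed.

Definition boundary_coef s t : R :=
  \sum_(j < size s) (-1) ^+ j * coef (delete_nth j s) t.

(** [match_mx] of [t] and [s] with a row of ones on top: Laplace expansion along
this row is the alternating sum over deletions that defines the boundary. *)
Definition cone_mx x0 n t s : 'M[R]_n.+1 :=
  \matrix_(i, j) ((i == ord0) || (nth x0 t i.-1 == nth x0 s j))%:R.

Lemma boundary_coef_det x0 n s t : size s = n.+1 -> size t = n ->
  boundary_coef s t = \det (cone_mx x0 n t s).
Proof.
move=> szs szt; rewrite (expand_det_row _ ord0) /boundary_coef szs.
apply: eq_bigr => j _; rewrite mxE eqxx mul1r /cofactor add0n; congr (_ * _).
rewrite (@oriented_coef_det x0 n) //; last first.
  rewrite size_cat size_drop size_take szs ltn_ord; have := ltn_ord j; lia.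
congr (\det _); apply/matrixP => i k; rewrite !mxE lift0 /=.
congr (_ == _)%:R; rewrite nth_cat size_takel ?szs; last by rewrite ltnW.
rewrite nth_drop /bump; case: ltnP => lt_kj; first by rewrite nth_take.
by rewrite addSn subnKC.
Qed.

Lemma cone_mx_mul x0 n t w s : uniq w -> size w = n.+1 -> size s = n.+1 ->
  size t = n -> perm_eq s w ->
  cone_mx x0 n t w *m match_mx x0 n.+1 w s = cone_mx x0 n t s.
Proof.
move=> uw szw szs szt sw; apply/matrixP => i k; rewrite !mxE.
have w_sk : nth x0 s k \in w by rewrite -(perm_mem sw) mem_nth ?szs.
have lt_k : (index (nth x0 s k) w < n.+1)%N by move: w_sk; rewrite -index_mem szw.
rewrite (bigD1 (Ordinal lt_k)) //= !mxE /= nth_index // eqxx mulr1 big1 ?addr0 //.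
move=> j; rewrite -val_eqE !mxE /= => neq_j.
case: (nth x0 w j =P _) => [eq_jk|]; last by rewrite mulr0.
by case/negP: neq_j; rewrite -eq_jk index_uniq ?szw.
Qed.

(** Reordering [s] multiplies [cone_mx] on the right by a permutation matrix, which
preserves the row of ones.  This is where the boundary of an oriented simplex is
seen to depend on its orientation only. *)
Lemma boundary_coef_reorderl s w t : uniq w -> perm_eq s w ->
  size w = (size t).+1 -> boundary_coef s t = coef s w * boundary_coef w t.
Proof.
move=> uw sw szw; have szs := perm_size sw; rewrite szw in szs.
case: w szw uw sw => // x0 w0; set w := x0 :: w0 => szw uw sw.
rewrite (boundary_coef_det x0 szs) // (boundary_coef_det x0 szw) //.
rewrite (oriented_coef_det x0 szs szw) mulrC -det_mulmx cone_mx_mul //.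
Qed.

Lemma boundary_coef_reorderr s t' t : uniq t' -> perm_eq t' t ->
  size s = (size t').+1 -> boundary_coef s t = boundary_coef s t' * coef t' t.
Proof.
move=> ut tt szs; rewrite /boundary_coef mulr_suml; apply: eq_bigr => j _.
rewrite -mulrA -oriented_coef_trans //.
by rewrite size_cat size_drop size_take ltn_ord; have := ltn_ord j; lia.
Qed.

End OrientationSign.

(** * Incidence numbers for a vertex ordering *)

Section Incidence.
Variables (R : realType) (V : finType) (rho : V -> nat).
Hypothesis rho_inj : injective rho.
Implicit Types (E F T : {set V}) (h g : {set V} -> R).
Local Notation coef := (oriented_coef R).

Definition sorted_enum F := sort (relpre rho leq) (enum F).

(** The incidence number of [F] and [F :\ x] when all faces are oriented by
increasing [rho]: the sign attached to the position of [x] in that ordering. *)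
Definition incid F x : R := (-1) ^+ #|[set v in F | (rho v < rho x)%N]|.

Lemma sorted_enum_perm F : perm_eq (sorted_enum F) (enum F).
Proof. by rewrite perm_sort. Qed.

Lemma mem_sorted_enum F : sorted_enum F =i F.
Proof. by move=> x; rewrite mem_sort mem_enum. Qed.

Lemma sorted_enum_uniq F : uniq (sorted_enum F).
Proof. by rewrite sort_uniq enum_uniq. Qed.

Lemma size_sorted_enum F : size (sorted_enum F) = #|F|.
Proof. by rewrite size_sort -cardE. Qed.

Lemma sorted_enum_sorted F : sorted (relpre rho ltn) (sorted_enum F).
Proof.
have: sorted ltn (map rho (sorted_enum F)); last by rewrite sorted_map.
rewrite ltn_sorted_uniq_leq (map_inj_uniq rho_inj) sorted_enum_uniq sorted_map.
by apply: sort_sorted => x y; apply: leq_total.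
Qed.

Lemma sorted_enum_delete F x : x \in F ->
  delete_nth (index x (sorted_enum F)) (sorted_enum F) = sorted_enum (F :\ x).
Proof.
move=> Fx; rewrite /delete_nth -remE rem_filter ?sorted_enum_uniq //.
have lt_trans : transitive (relpre rho ltn) by move=> y z t; apply: ltn_trans.
apply: (irr_sorted_eq lt_trans) => [y||| y]; rewrite ?sorted_enum_sorted //=.
- exact: ltnn.
- by rewrite sorted_filter ?sorted_enum_sorted.
by rewrite mem_filter !mem_sorted_enum !inE.
Qed.

Lemma index_sorted_enum F x : x \in F ->
  index x (sorted_enum F) = #|[set v in F | (rho v < rho x)%N]|.
Proof.
move=> Fx; set w := sorted_enum F; set i := index x w.
have lt_i : (i < size w)%N by rewrite index_mem mem_sorted_enum.
have def_x : nth x w i = x by rewrite nth_index // mem_sorted_enum.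
have -> : #|[set v in F | (rho v < rho x)%N]| = count (fun v => (rho v < rho x)%N) w.
  rewrite -size_filter cardE; apply/perm_size/uniq_perm.
  - exact: enum_uniq.
  - by rewrite filter_uniq ?sorted_enum_uniq.
  by move=> v; rewrite mem_enum mem_filter mem_sorted_enum inE andbC.
have := @Order.POrderTheory.count_lt_nth _ nat 0%N (map rho w) i.
rewrite size_map (nth_map x) // def_x count_map => <- //.
by rewrite sorted_map; apply: sorted_enum_sorted.
Qed.

Lemma boundary_coef_sorted F E : #|F| = #|E|.+1 ->
  boundary_coef R (sorted_enum F) (sorted_enum E) =
  \sum_(x in F) incid F x * (E == F :\ x)%:R.
Proof.
move=> szF; rewrite /boundary_coef.
have [x0 Fx0] : exists x, x \in F by apply/card_gt0P; rewrite szF.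
transitivity (\sum_(x <- sorted_enum F) incid F x * (E == F :\ x)%:R); last first.
  by rewrite (perm_big _ (sorted_enum_perm F)) big_enum.
rewrite (big_nth x0) big_mkord; apply: eq_bigr => j _.
set x := nth x0 _ j; have Fx : x \in F by rewrite -mem_sorted_enum mem_nth.
have def_j : index x (sorted_enum F) = j by rewrite index_uniq ?sorted_enum_uniq.
rewrite /incid -index_sorted_enum // def_j -[X in delete_nth X]def_j.
rewrite sorted_enum_delete //; congr (_ * _).
have [<-|neqE] := eqVneq E; first by rewrite oriented_coef_id ?sorted_enum_uniq.
apply/oriented_coef_perm/negP => /perm_mem eqE; case/eqP: neqE; apply/setP => y.
by rewrite -!(mem_sorted_enum _ y) eqE.
Qed.

(** Chains are functions on all sets of vertices; those of a complex vanish off its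
faces of one fixed dimension, which removes every dimension and membership
condition from the sums below. *)
Definition chain_boundary h E : R :=
  \sum_(x | x \notin E) incid (x |: E) x * h (x |: E).

Definition chain_coboundary g F : R := \sum_(x in F) incid F x * g (F :\ x).

Lemma incid_sqr F x : incid F x * incid F x = 1.
Proof. by rewrite -expr2 sqrr_sign. Qed.

Lemma sum_cofacets (phi : {set V} -> V -> R) :
  \sum_(E : {set V}) \sum_(x | x \notin E) phi E x =
  \sum_(F : {set V}) \sum_(x in F) phi (F :\ x) x.
Proof.
rewrite !pair_big_dep.
rewrite (reindex_onto (fun p : {set V} * V => (p.1 :\ p.2, p.2))
                      (fun p : {set V} * V => (p.2 |: p.1, p.2))) /=.
  apply: eq_bigl => -[F x] /=; rewrite !inE eqxx /= xpair_eqE eqxx andbT.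
  apply/eqP/idP => [<-|Fx]; [exact: setU11 | exact: setD1K].
by move=> [E x] /= notEx; rewrite setU1K.
Qed.

Lemma incidD1 T x y : y \in T ->
  incid T x = incid (T :\ y) x * (-1) ^+ (rho y < rho x)%N.
Proof.
move=> Ty; rewrite /incid -exprD (cardsD1 y) inE Ty /= addnC; congr (_ ^+ (_ + _)).
by apply: eq_card => v; rewrite !inE andbA.
Qed.

(** The two orders of deleting [x] and [y] carry opposite signs: this is the
vanishing of the boundary of a boundary. *)
Lemma incid_anticomm T x y : x \in T -> y \in T -> x != y ->
  incid (T :\ y) x * incid (T :\ x) y = - (incid T x * incid T y).
Proof.
move=> Tx Ty neq_xy; rewrite (incidD1 x Ty) (incidD1 y Tx) mulrACA.
rewrite -(exprD _ (rho y < rho x)%N).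
have -> : ((rho y < rho x) + (rho x < rho y))%N = 1%N.
  have: rho x != rho y by rewrite (inj_eq rho_inj).
  by case: ltngtP.
by rewrite expr1 mulrN1 opprK.
Qed.

(** The left side is the difference of the sum of squares and the square of the sum;
when at most one [a x] is nonzero all cross terms vanish, and then the right side
may vanish too. *)
Lemma cross_terms_bound T (a : V -> R) :
  - (\sum_(y in T) \sum_(x in T :\ y) a x * a y) <=
  \sum_(y in T) [exists x in T :\ y, a x != 0]%:R * a y ^+ 2.
Proof.
have [/existsP[y0 /and3P[Ty0 ay0 /existsP[x0 /andP[Tx0 ax0]]]]|] := boolP
    [exists y, [&& y \in T, a y != 0 & [exists x in T :\ y, a x != 0]]].
  (* Two nonzero terms x0, y0: every index y has a partner, y0 or x0. *)
  have -> : \sum_(y in T) [exists x in T :\ y, a x != 0]%:R * a y ^+ 2 =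
            \sum_(y in T) a y ^+ 2.
    apply: eq_bigr => y Ty; case: existsP => [|noy]; first by rewrite mul1r.
    have [-> | nz_y] := eqVneq (a y) 0; first by rewrite expr0n mulr0.
    case: noy; have [eq_y | neq_y] := eqVneq y y0.
      by exists x0; rewrite eq_y Tx0.
    by exists y0; rewrite !inE eq_sym neq_y Ty0.
  rewrite -subr_ge0 opprK -big_split /=.
  suff -> : \sum_(y in T) (a y ^+ 2 + \sum_(x in T :\ y) a x * a y) =
            (\sum_(y in T) a y) ^+ 2 by rewrite sqr_ge0.
  rewrite expr2 mulr_sumr; apply: eq_bigr => y Ty.
  by rewrite mulr_suml (big_setD1 y Ty) expr2.
rewrite negb_exists => /forallP none; rewrite big1 => [|y Ty].
  by rewrite oppr0 sumr_ge0 // => y _; rewrite mulr_ge0 ?sqr_ge0 ?ler0n.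
apply: big1 => x Tx; have := none y; rewrite Ty /= negb_and negbK.
case/orP=> [/eqP->|]; first by rewrite mulr0.
by rewrite negb_exists => /forallP/(_ x); rewrite Tx /= negbK => /eqP->; rewrite mul0r.
Qed.

(** The cross term of [E] at [x] and [y] is moved to the set [T] obtained by adding
both vertices to [E], where [incid_anticomm] turns it into a product of two terms
of the coboundary of [h] at [T]. *)
Lemma boundary_energy h :
  \sum_(E : {set V}) chain_boundary h E ^+ 2 = \sum_(F : {set V}) #|F|%:R * h F ^+ 2 -
    \sum_(T : {set V}) \sum_(y in T) \sum_(x in T :\ y)
       (incid T x * h (T :\ x)) * (incid T y * h (T :\ y)).
Proof.
pose c E x := incid (x |: E) x * h (x |: E).
have -> : \sum_(E : {set V}) chain_boundary h E ^+ 2 =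
    \sum_(E : {set V}) \sum_(x | x \notin E) c E x * chain_boundary h E.
  by apply: eq_bigr => E _; rewrite expr2 mulr_suml.
rewrite sum_cofacets.
have split_boundary F x : x \in F ->
    c (F :\ x) x * chain_boundary h (F :\ x) = h F ^+ 2 +
    \sum_(y | y \notin F) c (F :\ x) x * c (F :\ x) y.
  move=> Fx; rewrite mulr_sumr (bigD1 x) ?setD11 //=; congr (_ + _).
    by rewrite /c setD1K // mulrACA incid_sqr mul1r expr2.
  apply: eq_bigl => y; rewrite !inE negb_and negbK andbC.
  by case: eqVneq => [->|//]; rewrite Fx.
under eq_bigr => F _ do
  rewrite (eq_bigr _ (fun x Fx => split_boundary F x Fx)) big_split /=.
rewrite big_split /=; congr (_ + _).
  by apply: eq_bigr => F _; rewrite sumr_const mulr_natl.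
under eq_bigr do rewrite exchange_big /=.
rewrite (sum_cofacets (fun F y => \sum_(x in F) c (F :\ x) x * c (F :\ x) y)).
rewrite -sumrN; apply: eq_bigr => T _; rewrite -sumrN; apply: eq_bigr => y Ty.
rewrite -sumrN; apply: eq_bigr => x; rewrite !inE => /andP[neq_xy Tx].
have eq_y : x |: ((T :\ y) :\ x) = T :\ y by rewrite setD1K // !inE neq_xy.
have eq_x : y |: ((T :\ y) :\ x) = T :\ x.
  by rewrite setDDl [[set y] :|: [set x]]setUC -setDDl setD1K // !inE eq_sym neq_xy.
rewrite /c eq_x eq_y mulrACA incid_anticomm // mulNr; congr (- _).
by rewrite [in RHS]mulrACA; congr (_ * _); rewrite mulrC.
Qed.

(** Each [T] of [boundary_energy] is bounded by [cross_terms_bound]; summing over [T]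
and a deleted vertex is the same as summing over [F] and an added vertex [u]. *)
Lemma boundary_energy_bound h :
  \sum_(E : {set V}) chain_boundary h E ^+ 2 <= \sum_(F : {set V}) h F ^+ 2 *
    (#|F| + #|[set u | (u \notin F) && [exists x in F, h ((u |: F) :\ x) != 0]]|)%:R.
Proof.
rewrite boundary_energy.
have -> : \sum_(F : {set V}) h F ^+ 2 * (#|F| +
    #|[set u | (u \notin F) && [exists x in F, h ((u |: F) :\ x) != 0]]|)%:R =
  \sum_(F : {set V}) #|F|%:R * h F ^+ 2 + \sum_(F : {set V}) \sum_(u | u \notin F)
    [exists x in F, h ((u |: F) :\ x) != 0]%:R * h F ^+ 2.
  rewrite -big_split; apply: eq_bigr => F _ /=; rewrite natrD mulrDr mulrC.
  congr (_ + _); rewrite -mulr_suml mulrC -natr_sum; congr (_%:R * _).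
  by rewrite -sum1dep_card big_mkcondr.
rewrite lerD2l (sum_cofacets (fun F u =>
  [exists x in F, h ((u |: F) :\ x) != 0]%:R * h F ^+ 2)).
rewrite -sumrN; apply: ler_sum => T _.
apply: le_trans (cross_terms_bound T (fun x => incid T x * h (T :\ x))) _.
rewrite le_eqVlt; apply/orP; left; apply/eqP; apply: eq_bigr => y Ty.
rewrite setD1K // exprMn [incid T y ^+ 2]expr2 incid_sqr mul1r.
congr ((nat_of_bool _)%:R * _).
apply: eq_existsb => x; congr (_ && _).
by rewrite mulf_eq0 signr_eq0.
Qed.

(** * The up-Laplacian of a complex and its upper bound *)

Section Complex.
Variables (K : {set {set V}}) (o : {set V} -> seq V) (k : nat).
Hypotheses (K_complex : simplicial_complex K) (K_oriented : orientation K o).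
Local Notation boundary := (boundary_mx R o K k).

(** The discrepancy between the orientation [o] and the one increasing in [rho]. *)
Definition osign F : R := coef (o F) (sorted_enum F).

Lemma orientation_face n F : F \in faces K n ->
  [/\ F \in K, #|F| = n.+1, uniq (o F), perm_eq (o F) (sorted_enum F)
    & size (o F) = n.+1].
Proof.
rewrite inE => /andP[KF /eqP szF]; have oF := K_oriented KF.
split=> //; first by rewrite (perm_uniq oF) enum_uniq.
  by rewrite (perm_trans oF) // perm_sym sorted_enum_perm.
by rewrite (perm_size oF) -cardE.
Qed.

Lemma osign_sqr n F : F \in faces K n -> osign F * osign F = 1.
Proof. by case/orientation_face=> _ _ uoF oF _; apply: oriented_coef_sqr. Qed.

Lemma faces_D1 F x : F \in faces K k.+1 -> x \in F -> F :\ x \in faces K k.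
Proof.
rewrite !inE => /andP[KF /eqP szF] Fx; rewrite (K_complex KF) ?subD1set //=.
by move: szF; rewrite (cardsD1 x) Fx add1n => -[->].
Qed.

(** A change of orientations multiplies the rows and columns of the boundary matrix by
signs. *)
Lemma boundary_mxE i l (F := enum_val i) (E := enum_val l) :
  boundary i l =
  osign F * osign E * \sum_(x in F) incid F x * (E == F :\ x)%:R.
Proof.
have /orientation_face[KF szF uF oF szoF] := enum_valP i.
have /orientation_face[KE szE uE oE szoE] := enum_valP l.
rewrite -/F -/E in KF szF uF oF szoF KE szE uE oE szoE *.
have -> : boundary i l = boundary_coef R (o F) (o E).
  by rewrite mxE summxE; apply: eq_bigr => j _; rewrite !mxE.
rewrite (boundary_coef_reorderl R (sorted_enum_uniq F)) //; last first.
  by rewrite size_sorted_enum szF szoE.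
rewrite (boundary_coef_reorderr R (sorted_enum_uniq E)); first last.
- by rewrite !size_sorted_enum szF szE.
- by rewrite perm_sym.
have -> : coef (sorted_enum E) (o E) = osign E.
  by apply: oriented_coefC; rewrite size_sorted_enum szE.
rewrite boundary_coef_sorted ?szF ?szE //.
by rewrite [X in _ * X]mulrC mulrA.
Qed.

(** The coordinates of [h] in the basis oriented by [o], when [h] is given in the
orientations increasing in [rho]. *)
Definition chain_row n h : 'rV[R]_#|faces K n| :=
  \row_i (osign (enum_val i) * h (enum_val i)).

Lemma chain_row_surj n (y : 'rV_#|faces K n|) :
  exists2 h, forall F, F \notin faces K n -> h F = 0 & y = chain_row n h.
Proof.
pose h F := \sum_(i | enum_val i == F) osign F * y 0 i.
exists h => [F nF | ].
  by apply: big_pred0 => i; apply/eqP => eqF; rewrite -eqF enum_valP in nF.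
apply/rowP => i; rewrite mxE /h (big_pred1 i) => [|j]; last first.
  by rewrite (inj_eq enum_val_inj).
by rewrite mulrA (osign_sqr (enum_valP i)) mul1r.
Qed.

Lemma chain_row_dot n h g :
  (chain_row n h *m (chain_row n g)^T) 0 0 = \sum_(F in faces K n) h F * g F.
Proof.
rewrite mxE [RHS]big_enum_val; apply: eq_bigr => i _; rewrite !mxE.
by rewrite mulrACA (osign_sqr (enum_valP i)) mul1r.
Qed.

Lemma chain_row_boundary h : (forall F, F \notin faces K k.+1 -> h F = 0) ->
  chain_row k.+1 h *m boundary = chain_row k (chain_boundary h).
Proof.
move=> h0; apply/rowP => l; set E := enum_val l; rewrite !mxE.
transitivity (\sum_(F in faces K k.+1)
    osign E * \sum_(x in F) incid F x * h F * (E == F :\ x)%:R).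
  rewrite [RHS]big_enum_val; apply: eq_bigr => i _; rewrite mxE boundary_mxE.
  rewrite -/E -[osign _ * osign E * _]mulrA mulrACA (osign_sqr (enum_valP i)) mul1r.
  rewrite mulrCA; congr (_ * _); rewrite mulr_sumr; apply: eq_bigr => x _.
  by rewrite mulrA [h _ * _]mulrC.
rewrite -mulr_sumr; congr (_ * _); rewrite /chain_boundary.
transitivity (\sum_(F : {set V}) \sum_(x in F) incid F x * h F * (E == F :\ x)%:R).
  rewrite big_mkcond; apply: eq_bigr => F _; case: ifPn => // /h0 hF.
  by rewrite big1 // => x _; rewrite hF mulr0 mul0r.
transitivity (\sum_(E' : {set V}) \sum_(x | x \notin E')
    incid (x |: E') x * h (x |: E') * (E == E')%:R).
  rewrite (sum_cofacets (fun E' x => incid (x |: E') x * h (x |: E') * (E == E')%:R)).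
  by apply: eq_bigr => F _; apply: eq_bigr => x Fx; rewrite setD1K.
rewrite (bigD1 E) //= [X in _ + X]big1 ?addr0 => [|E' neqE].
  by apply: eq_bigr => x _; rewrite eqxx mulr1.
by apply: big1 => x _; rewrite eq_sym (negPf neqE) mulr0.
Qed.

Lemma chain_row_coboundary g :
  chain_row k g *m boundary^T = chain_row k.+1 (chain_coboundary g).
Proof.
apply/rowP => i; set F := enum_val i; rewrite !mxE.
transitivity (\sum_(E in faces K k)
    osign F * \sum_(x in F) incid F x * g E * (E == F :\ x)%:R).
  rewrite [RHS]big_enum_val; apply: eq_bigr => l _.
  rewrite [chain_row _ _ _ _]mxE [_^T _ _]mxE boundary_mxE.
  rewrite -/F [osign F * _]mulrC -[osign _ * osign F * _]mulrA mulrACA.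
  rewrite (osign_sqr (enum_valP l)) mul1r.
  rewrite mulrCA; congr (_ * _); rewrite mulr_sumr; apply: eq_bigr => x _.
  by rewrite mulrA [g _ * _]mulrC.
rewrite -mulr_sumr; congr (_ * _); rewrite exchange_big; apply: eq_bigr => x Fx /=.
rewrite (bigD1 (F :\ x)) ?faces_D1 ?enum_valP //= eqxx mulr1 big1 ?addr0 //.
by move=> E /andP[_ /negPf->]; rewrite mulr0.
Qed.

(** The vertices of [F] belong to the union because [u \in F] completes the facet
[F :\ u] to [F] itself. *)
Lemma facet_nbhd_card F : F \in faces K k.+1 ->
  (#|F| + #|[set u | (u \notin F) && [exists x in F, ((u |: F) :\ x) \in faces K k.+1]]|
    <= #|facet_nbhd k.+1 K F|)%N.
Proof.
move=> KF; set U := [set u | _].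
have FU0 : [disjoint F & U].
  rewrite -setI_eq0; apply/eqP/setP => u; rewrite !inE.
  by case: (u \in F).
rewrite -[(_ + _)%N](_ : #|F :|: U| = _)%N; last first.
  by apply/eqP; rewrite (leq_card_setU F U).2.
have facet_mem x : x \in F -> F :\ x \in facets k.+1 K F.
  by move=> Fx; rewrite inE faces_D1 // subD1set.
have vertex_mem G u : G \in faces K k.+1 -> u \in G -> u \in vertices K.
  by rewrite !inE => /andP[KG _] Gu; apply: K_complex KG _; rewrite sub1set.
apply/subset_leq_card/subsetP => u; rewrite !inE => /orP[Fu | /andP[nFu]].
  apply/bigcupP; exists (F :\ u); first exact: facet_mem.
  by rewrite inE setD1K // inE setD11 (vertex_mem F).
case/existsP=> x /andP[Fx KG]; apply/bigcupP; exists (F :\ x); first exact: facet_mem.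
have neq_ux : u != x by apply: contraNneq nFu => ->.
have eqG : u |: (F :\ x) = (u |: F) :\ x.
  apply/setP => v; rewrite !inE; case: (eqVneq v x) => //= ->.
  by rewrite eq_sym (negPf neq_ux).
rewrite inE eqG KG andbT inE (vertex_mem _ _ KG) ?andbT; last first.
  by rewrite !inE eqxx neq_ux.
by rewrite !inE (negPf nFu) andbF.
Qed.

Lemma boundary_energy_max h : (forall F, F \notin faces K k.+1 -> h F = 0) ->
  \sum_E chain_boundary h E ^+ 2 <=
  (max_facet_nbhd k.+1 K)%:R * \sum_(F in faces K k.+1) h F ^+ 2.
Proof.
move=> h0; apply: le_trans (boundary_energy_bound h) _.
rewrite mulr_sumr [leRHS]big_mkcond; apply: ler_sum => F _ /=.
case: ifPn => [KF | /h0->]; last by rewrite expr0n mul0r.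
rewrite mulrC ler_wpM2r ?sqr_ge0 // ler_nat.
rewrite /max_facet_nbhd; apply: (bigop.bigmax_sup F) => //.
apply: (leq_trans _ (facet_nbhd_card KF)); rewrite leq_add2l.
apply/subset_leq_card/subsetP => u; rewrite !inE => /andP[-> /existsP[x /andP[Fx hx]]].
apply/existsP; exists x; rewrite Fx /=; apply: contraNT hx => /h0->; exact: eqxx.
Qed.

Lemma row_dot_ge0 n (x : 'rV[R]_n) : 0 <= (x *m x^T) 0 0.
Proof. by rewrite mxE sumr_ge0 // => i _; rewrite mxE -expr2 sqr_ge0. Qed.

Lemma row_dot_gt0 n (x : 'rV[R]_n) : x != 0 -> 0 < (x *m x^T) 0 0.
Proof.
rewrite lt_def row_dot_ge0 andbT; apply: contraNneq => /eqP.
rewrite mxE psumr_eq0 => [/allP x0|i _]; last by rewrite mxE -expr2 sqr_ge0.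
apply/eqP/rowP => i; have := x0 i (mem_index_enum _); rewrite mxE mulf_eq0 orbb.
by move/eqP->; rewrite mxE.
Qed.

(** With [f] the image of an eigenvector [y] under the adjoint of the boundary map,
[b] times the squared norm of [f] is the squared norm of its boundary. *)
Theorem up_laplacian_eigenvalue_le b : eigenvalue (up_laplacian R o K k) b ->
  b <= (max_facet_nbhd k.+1 K)%:R.
Proof.
case/eigenvalueP=> y; rewrite /up_laplacian mulmxA => eig_y nz_y.
set f := y *m boundary^T in eig_y; have [f0 | nz_f] := eqVneq f 0.
  have /eqP := eig_y; rewrite f0 mul0mx eq_sym scaler_eq0 (negPf nz_y) orbF.
  by move/eqP->; rewrite ler0n.
have [h h0 def_f] := chain_row_surj f.
have eig_f : (f *m boundary *m (f *m boundary)^T) 0 0 = b * (f *m f^T) 0 0.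
  by rewrite trmx_mul mulmxA eig_y -!scalemxAl -/f mxE.
rewrite -(ler_pM2r (row_dot_gt0 nz_f)) -eig_f def_f chain_row_boundary //.
rewrite !chain_row_dot.
apply: le_trans (boundary_energy_max h0).
rewrite big_mkcond; apply: ler_sum => E _.
by case: ifP; rewrite ?expr2 // -expr2 sqr_ge0.
Qed.

(** The eigenvector is the boundary of [h]; it is nonzero because its coboundary is
[a] times [h] on the faces and [a != 0]. *)
Theorem up_laplacian_eigenvalue h a : (forall F, F \notin faces K k.+1 -> h F = 0) ->
    (forall F, F \in faces K k.+1 -> chain_coboundary (chain_boundary h) F = a * h F) ->
    (exists F, h F != 0) -> a != 0 ->
  eigenvalue (up_laplacian R o K k) a.
Proof.
move=> h0 eig_h [F0 hF0] nz_a; have KF0 : F0 \in faces K k.+1.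
  by apply: contraNT hF0 => /h0->.
have eig_row : chain_row k (chain_boundary h) *m boundary^T = a *: chain_row k.+1 h.
  rewrite chain_row_coboundary; apply/rowP => i; rewrite !mxE.
  by rewrite eig_h ?enum_valP // mulrCA.
apply/eigenvalueP; exists (chain_row k (chain_boundary h)).
  by rewrite mulmxA eig_row -scalemxAl chain_row_boundary.
apply: contraNneq hF0 => bd0; move: eig_row; rewrite bd0 mul0mx => /rowP.
move/(_ (enum_rank_in KF0 F0)); rewrite !mxE enum_rankK_in // => /esym/eqP.
rewrite !mulf_eq0 (negPf nz_a) /=; case/orP=> // /eqP s0.
by have /eqP := osign_sqr KF0; rewrite s0 mul0r eq_sym oner_eq0.
Qed.

End Complex.

End Incidence.

(** * Partite semiregular complexes *)

Section Partite.
Variables (V : finType) (r : nat) (P : 'I_r.+1 -> {set V}).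
Hypothesis P_partition : vertex_partition P.
Implicit Types (E F S : {set V}).

(** By [mem_part], the default [ord0] is never used when [P] is a partition. *)
Definition part_of (v : V) : 'I_r.+1 := odflt ord0 [pick i | v \in P i].

Lemma mem_part v i : (v \in P i) = (part_of v == i).
Proof.
have [_ P_disj P_cover] := P_partition.
have Pv : v \in P (part_of v).
  rewrite /part_of; case: pickP => [//|no_i].
  have: v \in \bigcup_i P i by rewrite P_cover inE.
  by case/bigcupP=> l _; rewrite no_i.
apply/idP/eqP => [Pv_i | <- //]; apply/eqP; apply: contraTT Pv_i => neq_i.
by have := disjointFr (P_disj _ _ neq_i) Pv => /negbT.
Qed.

Lemma sum_by_part (A : nmodType) S (phi : V -> A) :
  \sum_(v in S) phi v = \sum_i \sum_(v in S :&: P i) phi v.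
Proof.
rewrite (partition_big part_of xpredT) //=; apply: eq_bigr => i _.
by apply: eq_bigl => v; rewrite inE mem_part.
Qed.

Lemma card_by_part S : #|S| = (\sum_i #|S :&: P i|)%N.
Proof.
rewrite -sum1_card (partition_big part_of xpredT) //=; apply: eq_bigr => i _.
by rewrite -sum1_card; apply: eq_bigl => v; rewrite inE mem_part.
Qed.

(** A vertex ordering that goes through the parts one after the other, so that the
incidence numbers of the faces of [C] are given by part indices. *)
Definition part_rank (v : V) : nat := (part_of v * #|V| + enum_rank v)%N.

Lemma part_rank_inj : injective part_rank.
Proof.
move=> u v /(congr1 (modn^~ #|V|)); rewrite /= !modnMDl !modn_small ?ltn_ord //.
by move/val_inj/enum_rank_inj.
Qed.

Lemma part_rank_lt u v : part_of u != part_of v ->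
  (part_rank u < part_rank v)%N = (part_of u < part_of v)%N.
Proof.
move=> neq_uv.
have part_lt a b : (part_of a < part_of b)%N -> (part_rank a < part_rank b)%N.
  move=> lt_ab; apply: leq_trans (_ : (part_of a).+1 * #|V| <= _)%N.
    by rewrite mulSnr ltn_add2l ltn_ord.
  by rewrite (leq_trans _ (leq_addr _ _)) // leq_mul2r lt_ab orbT.
have: part_of u != part_of v :> nat by [].
case: (ltngtP (part_of u) (part_of v)) => // lt_uv _; first exact: part_lt.
by apply/negbTE; rewrite -leqNgt ltnW // part_lt.
Qed.

(** Exactly the sets on which [semiregular] prescribes the degree of part [j]; their
cardinality [r] is a consequence, [card_misses_part]. *)
Definition misses_part S j : Prop :=
  S \subset ~: P j /\ (forall i, i != j -> #|S :&: P i| = 1%N).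

Lemma card_misses_part S j : misses_part S j -> #|S| = r.
Proof.
case=> Sj S1; rewrite card_by_part (bigD1 j) //=.
rewrite (eq_bigr (fun=> 1%N)) // sum1_card cardC1 card_ord.
rewrite (_ : S :&: P j = set0) ?cards0 //.
by apply/eqP; rewrite setI_eq0 disjoints_subset.
Qed.

Lemma misses_partD1 S x : one_per_part P S -> x \in S ->
  misses_part (S :\ x) (part_of x).
Proof.
move=> S1 Sx; split=> [|i neq_i].
  apply/subsetP => v; rewrite !inE => /andP[neq_vx Sv]; apply: contraNN neq_vx => Pv.
  have /eqP/cards1P[z Pz] := S1 (part_of x).
  have: v \in S :&: P (part_of x) by rewrite inE Sv.
  have: x \in S :&: P (part_of x) by rewrite inE Sx mem_part eqxx.
  by rewrite Pz !inE => /eqP-> /eqP->.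
rewrite -(S1 i); apply: eq_card => v; rewrite !inE.
case: eqVneq => // ->; rewrite mem_part eq_sym (negPf neq_i) /=.
by rewrite andbF.
Qed.

Lemma one_per_partU1 S j x : misses_part S j -> x \in P j ->
  one_per_part P (x |: S).
Proof.
case=> Sj S1 Px i; have [-> | neq_i] := eqVneq i j.
  apply/eqP/cards1P; exists x; apply/setP => v; rewrite !inE.
  case: eqVneq => [->|_] //=; apply/andP => -[Sv Pv].
  by have := subsetP Sj v Sv; rewrite inE Pv.
rewrite -(S1 i neq_i); apply: eq_card => v; rewrite !inE.
case: eqVneq => // ->; move: Px; rewrite !mem_part => /eqP->.
by rewrite eq_sym (negPf neq_i) !andbF.
Qed.

Lemma misses_part_cofacet S x : x \notin S -> one_per_part P (x |: S) ->
  misses_part S (part_of x).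
Proof.
by move=> nSx S1; rewrite -[S](setU1K nSx); apply: misses_partD1; rewrite ?setU11.
Qed.

Lemma misses_part_inj S i j : misses_part S i -> misses_part S j -> i = j.
Proof.
case=> Si _ [_ Sj]; apply/eqP; apply: contraTT isT => /Sj/eqP/cards1P[v defv].
have: v \in S :&: P i by rewrite defv set11.
by rewrite inE => /andP[/(subsetP Si)]; rewrite inE => /negPf->.
Qed.

Section Sign.
Variable R : realType.
Local Notation incid := (incid R part_rank).
Local Notation chain_boundary := (chain_boundary (R := R) part_rank).
Local Notation chain_coboundary := (chain_coboundary (R := R) part_rank).

(** Replacing [x] by another vertex of its part does not alter this exponent; the
comparison inside the part, which depends on the arbitrary choice made in
[part_rank], has been eliminated. *)
Lemma incid_part S x : (forall v, v \in S -> part_of v = part_of x -> v = x) ->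
  incid S x = (-1) ^+ #|[set v in S | (part_of v < part_of x)%N]|.
Proof.
move=> Sx; congr (_ ^+ _); apply: eq_card => v; rewrite !inE.
case Sv: (v \in S) => //=.
have [eq_v | /part_rank_lt//] := eqVneq (part_of v) (part_of x).
by rewrite (Sx v Sv eq_v) !ltnn.
Qed.

Lemma card_lower_parts S (j : 'I_r.+1) : (forall i, i != j -> #|S :&: P i| = 1%N) ->
  #|[set v in S | (part_of v < j)%N]| = j.
Proof.
move=> S1; rewrite card_by_part.
transitivity (\sum_(i < r.+1) (i < j)%N)%N.
  apply: eq_bigr => i _; case: ltnP => [lt_ij|le_ji].
    transitivity #|S :&: P i|; last by apply: S1; rewrite -val_eqE ltn_eqF.
    apply: eq_card => v; rewrite !inE mem_part.
    by case: eqVneq => [->|]; rewrite ?lt_ij ?andbT ?andbF.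
  apply/eqP; rewrite cards_eq0; apply/eqP/setP => v; rewrite !inE mem_part.
  by case: eqVneq => [->|]; rewrite ?andbF // ltnNge le_ji andbF.
rewrite -big_mkcond /= -(big_ord_widen _ (fun=> 1%N)) ?sum1_card ?card_ord //.
exact: ltnW.
Qed.

Lemma incid_missing S j x : misses_part S j -> x \in P j ->
  incid (x |: S) x = (-1) ^+ j.
Proof.
move=> Sj Px; have S1 := one_per_partU1 Sj Px.
move: (Px); rewrite mem_part => /eqP def_j.
rewrite incid_part => [|v Sv eq_v].
  by rewrite def_j card_lower_parts // => i _; apply: S1.
have /eqP/cards1P[z Pz] := S1 j.
have: v \in (x |: S) :&: P j by rewrite inE Sv mem_part eq_v def_j eqxx.
have: x \in (x |: S) :&: P j by rewrite inE setU11.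
by rewrite Pz !inE => /eqP-> /eqP->.
Qed.

Variables (C : {set {set V}}) (d : 'I_r.+1 -> nat).
Hypotheses (C_partite : partite P C) (C_regular : semiregular P C d).

Definition face_indicator S : R := (S \in faces C r)%:R.

(** The cofacets of [S] in [C] all add a vertex of [P j], hence all carry the sign
[(-1) ^+ j], and semiregularity says that there are [d j] of them. *)
Lemma boundary_indicator_missing S j : misses_part S j ->
  chain_boundary face_indicator S = (-1) ^+ j * (d j)%:R.
Proof.
move=> Sj; have [_ one_C] := C_partite.
have [_ /(_ S (card_misses_part Sj) (proj1 Sj) (proj2 Sj)) <-] := C_regular j.
rewrite /part_degree -sum1dep_card natr_sum mulr_sumr.
rewrite /chain_boundary [RHS]big_mkcond [LHS]big_mkcond; apply: eq_bigr => x _.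
rewrite /face_indicator; case CxS: (x |: S \in faces C r); last first.
  by rewrite andbF mulr0 if_same.
rewrite andbT mulr1; have Sx1 := one_C _ CxS.
case: ifPn => [nSx | Sx].
  have eq_j := misses_part_inj (misses_part_cofacet nSx Sx1) Sj.
  have Px : x \in P j by rewrite mem_part eq_j.
  by rewrite Px (incid_missing Sj Px) mulr1.
case: ifP => // Px; have := subsetP (proj1 Sj) x (negbNE Sx).
by rewrite inE Px.
Qed.

Lemma boundary_indicator_eq0 S : (forall j, ~ misses_part S j) ->
  chain_boundary face_indicator S = 0.
Proof.
move=> noS; have [_ one_C] := C_partite; apply: big1 => x nSx.
rewrite /face_indicator; case CxS: (x |: S \in faces C r); last by rewrite mulr0.
by case: (noS _ (misses_part_cofacet nSx (one_C _ CxS))).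
Qed.

(** The facet missing part [i] has incidence number [(-1) ^+ i] and value
[(-1) ^+ i * d i], so the signs cancel. *)
Lemma coboundary_boundary_transversal F : one_per_part P F ->
  chain_coboundary (chain_boundary face_indicator) F = (\sum_i d i)%N%:R.
Proof.
move=> F1; rewrite /chain_coboundary sum_by_part natr_sum; apply: eq_bigr => i _.
have /eqP/cards1P[x def_x] := F1 i.
have: x \in F :&: P i by rewrite def_x set11.
rewrite inE => /andP[Fx Px]; rewrite def_x big_set1.
have Fi : misses_part (F :\ x) i.
  by move: (Px); rewrite mem_part => /eqP<-; apply: misses_partD1.
rewrite (boundary_indicator_missing Fi) -{1}(setD1K Fx) (incid_missing Fi Px) mulrA.
by rewrite -expr2 sqrr_sign mul1r.
Qed.

(** If no [F :\ x] has a single vertex in each part but one, all terms vanish.  If some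
[F :\ x0] does, missing part [j], then [F] has exactly two vertices [x0], [x1]
in one other part.  Only the two facets omitting [x0] or [x1] matter; both miss
[j], so they have the same value, and their incidence numbers are opposite because
no vertex of [F] lies between [x0] and [x1] in [part_rank]. *)
Lemma coboundary_boundary_not_transversal F : ~ one_per_part P F ->
  chain_coboundary (chain_boundary face_indicator) F = 0.
Proof.
move=> nF1.
pose missP S j := (S \subset ~: P j) && [forall (i | i != j), #|S :&: P i| == 1%N].
have missE S j : reflect (misses_part S j) (missP S j).
  apply: (iffP andP) => -[Sj S1]; split=> //.
    by move=> i neq_i; apply/eqP; move/forall_inP: S1; apply.
  by apply/forall_inP => i /S1/eqP.
have [/existsP[x0 /andP[Fx0 /existsP[j /missE Fj]]]|] :=
    boolP [exists x, (x \in F) && [exists j, missP (F :\ x) j]]; last first.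
  rewrite negb_exists => /forallP noF; apply: big1 => x Fx.
  rewrite boundary_indicator_eq0 ?mulr0 // => j Fj; case/negP: (noF x).
  by rewrite Fx; apply/existsP; exists j; apply/missE.
set i := part_of x0; have Px0 : x0 \in P i by rewrite mem_part.
have neq_ij : i != j.
  apply/eqP => eq_ij; case: nF1; rewrite -(setD1K Fx0).
  by apply: (one_per_partU1 Fj); rewrite -eq_ij.
have /eqP/cards1P[x1 def_x1] := (proj2 Fj) i neq_ij.
have: x1 \in (F :\ x0) :&: P i by rewrite def_x1 set11.
rewrite !inE -andbA => /and3P[neq_x Fx1 Px1].
have only2 v : v \in F -> v \in P i -> (v == x0) || (v == x1).
  move=> Fv Pv; case: eqVneq => //= neq_v.
  by rewrite -in_set1 -def_x1 !inE neq_v Fv.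
have Fj1 : misses_part (F :\ x1) j.
  split=> [|l neq_lj].
    apply/subsetP => v; rewrite !inE => /andP[_ Fv].
    have [->|neq_v] := eqVneq v x0; first by rewrite mem_part.
    by have := subsetP (proj1 Fj) v; rewrite !inE neq_v Fv => ->.
  have [->|neq_li] := eqVneq l i.
    apply/eqP/cards1P; exists x0; apply/setP => v; rewrite !inE.
    apply/idP/eqP => [/andP[/andP[neq_v Fv] Pv]|->].
      by have := only2 v Fv Pv; rewrite (negPf neq_v) orbF => /eqP.
    by rewrite eq_sym neq_x Fx0.
  rewrite -((proj2 Fj) l neq_lj); apply: eq_card => v; rewrite !inE.
  case Pv: (v \in P l); rewrite ?andbF // !andbT.
  have /negPf-> : v != x0.
    by apply: contraTneq Pv => ->; rewrite mem_part eq_sym.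
  suff /negPf-> : v != x1 by [].
  by apply: contraTneq Pv => ->; move: Px1; rewrite !mem_part => /eqP->; rewrite eq_sym.
have part1 : part_of x1 = i by apply/eqP; rewrite -mem_part.
rewrite /chain_coboundary (bigD1 x0) //= (bigD1 x1) /=; last by rewrite Fx1.
rewrite big1 ?addr0 => [|y /andP[/andP[Fy neq_y0] neq_y1]]; last first.
  rewrite boundary_indicator_eq0 ?mulr0 // => l [Fl F1].
  have Fyi : [set x0; x1] \subset (F :\ y) :&: P i.
    apply/subsetP => v; rewrite !inE => /orP[] /eqP->.
      by rewrite Px0 Fx0 !andbT eq_sym.
    by rewrite Px1 Fx1 !andbT eq_sym.
  have [eq_il|neq_il] := eqVneq i l.
    by have := subsetP Fl x0; rewrite !inE -eq_il Px0 Fx0 eq_sym neq_y0 => /(_ isT).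
  by have := subset_leq_card Fyi; rewrite cards2 eq_sym neq_x F1.
rewrite !(boundary_indicator_missing Fj, boundary_indicator_missing Fj1) -mulrDl.
suff -> : incid F x0 + incid F x1 = 0 by rewrite mul0r.
have lowE x y : x \in F -> y \in F -> part_of x = i -> part_of y = i ->
    x != y -> (forall v, v \in F -> v \in P i -> (v == x) || (v == y)) ->
  incid F x = (-1) ^+ #|[set v in F | (part_of v < i)%N]| *
    (-1) ^+ (part_rank y < part_rank x)%N.
  move=> Fx Fy xi yi neq_xy onlyxy; rewrite (incidD1 _ _ _ Fy); congr (_ * _).
  rewrite incid_part => [|v]; last first.
    rewrite !inE => /andP[neq_v Fv] eq_v; have := onlyxy v Fv.
    by rewrite mem_part eq_v xi eqxx (negPf neq_v) orbF => /(_ isT)/eqP.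
  congr (_ ^+ _); apply: eq_card => v; rewrite !inE xi.
  by case: eqVneq => // ->; rewrite yi ltnn !andbF.
rewrite (lowE x0 x1) // 1?eq_sym // (lowE x1 x0) //; last first.
  by move=> v Fv Pv; rewrite orbC; apply: only2.
rewrite -mulrDr.
have: part_rank x0 != part_rank x1 by rewrite (inj_eq part_rank_inj) eq_sym.
by case: ltngtP => // _ _; rewrite expr0 expr1 ?subrr ?addNr mulr0.
Qed.

End Sign.

Variables (C Cp : {set {set V}}) (d : 'I_r.+1 -> nat).
Hypotheses (C_partite : partite P C) (C_regular : semiregular P C d).

Lemma transversal_vertices F : one_per_part P F ->
  exists2 x : 'I_r.+1 -> V, (forall i, x i \in P i) & F = [set x i | i : 'I_r.+1].
Proof.
move=> F1; have ex_x i : exists v, F :&: P i = [set v].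
  by apply/cards1P; rewrite F1.
have [x Fx] := fin_all_exists ex_x.
have memx i : x i \in F :&: P i by rewrite Fx set11.
exists x => [i|]; first by have := memx i; rewrite inE => /andP[].
apply/setP => v; apply/idP/imsetP => [Fv|[i _ ->]]; last first.
  by have := memx i; rewrite inE => /andP[].
exists (part_of v) => //; apply/set1P; rewrite -Fx inE Fv mem_part eqxx //.
Qed.

(** Let [u] in part [i] complete the facet of [F] omitting [x j].  If [i = j] the
result meets every part once, so it is not an added face; if [i != j] it has two
vertices in part [i], so it is an added face and the exchange condition applies. *)
Lemma facet_nbhd_transversal F : (0 < r)%N -> admissible_additions P C Cp ->
  F \in faces C r -> (#|facet_nbhd r Cp F| <= \sum_i d i)%N.
Proof.
move=> r_gt0 [_ _ added_not_one exchange] CF; have F1 := (proj2 C_partite) F CF.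
have [x Px def_F] := transversal_vertices F1.
have Fx i : x i \in F by rewrite def_F imset_f.
have partx i : part_of (x i) = i by apply/eqP; rewrite -mem_part.
have Fmiss i : misses_part (F :\ x i) i.
  by have := misses_partD1 F1 (Fx i); rewrite partx.
have cardF : #|F| = r.+1 by move: CF; rewrite inE => /andP[_ /eqP].
rewrite card_by_part; apply: leq_sum => i _.
have [Fi F1i] := Fmiss i.
have [_ /(_ _ (card_misses_part (Fmiss i)) Fi F1i) <-] := C_regular i.
apply/subset_leq_card/subsetP => u; rewrite !inE => /andP[Nu Pu]; rewrite Pu /=.
case/bigcupP: Nu => E; rewrite !inE => /andP[/andP[_ /eqP cardE] subEF].
move=> /andP[/andP[nEu _] CpuE].
have uE_face : u |: E \in faces Cp r by rewrite inE.
have [j def_E] : exists j, E = F :\ x j.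
  have [y Fy nEy] : exists2 y, y \in F & y \notin E.
    by apply/subsetPn/negP => /subset_leq_card; rewrite cardF cardE; lia.
  move: (Fy); rewrite {1}def_F => /imsetP[j _ def_y]; exists j.
  apply/eqP; rewrite eqEcard -def_y; apply/andP; split.
    by rewrite subsetD1 subEF.
  by have := cardsD1 y F; rewrite Fy cardF cardE; lia.
have [eq_ij | neq_ij] := eqVneq i j.
  have one_uE : one_per_part P (u |: E).
    by rewrite def_E; apply: (one_per_partU1 (Fmiss j)); rewrite -eq_ij.
  rewrite eq_ij -def_E; apply/negPn/negP => nC.
  by apply: (added_not_one (u |: E)) => //; rewrite inE uE_face andbT inE.
have nC : u |: E \notin faces C r.
  apply/negP => /((proj2 C_partite) _) one_uE.
  have uE_miss := misses_part_cofacet nEu one_uE.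
  case/eqP: neq_ij; apply: misses_part_inj (Fmiss j); rewrite -def_E.
  by move: Pu; rewrite mem_part => /eqP <-.
have := exchange x Px; rewrite /= -def_F => /(_ CF i j u neq_ij Pu).
by rewrite -def_E inE uE_face nC inE => /(_ isT).
Qed.

End Partite.

(** * The largest eigenvalue *)

Lemma Fplus_lambda_max (R : realType) (V : finType) (k : nat)
    (P : 'I_k.+2 -> {set V}) (C Cp : {set {set V}}) (d : 'I_k.+2 -> nat)
    (o : {set V} -> seq V) :
  vertex_partition P -> partite P C -> semiregular P C d ->
  Fplus_of P C d Cp -> orientation Cp o ->
  is_lambda_max (up_laplacian R o Cp k) (max_facet_nbhd k.+1 Cp)%:R /\
  max_facet_nbhd k.+1 Cp = (\sum_i d i)%N.
Proof.
move=> P_part C_part C_reg [adm added_small] oCp.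
have [[Cp_complex _ _] subC added_not_one _] := adm.
have [_ [[F0 CF0] _] _] := proj1 C_part.
have rank_inj := @part_rank_inj V k.+1 P.
have ub := up_laplacian_eigenvalue_le rank_inj Cp_complex oCp.
have eig : eigenvalue (up_laplacian R o Cp k) (\sum_i d i)%N%:R.
  apply: (@up_laplacian_eigenvalue R V (part_rank P) rank_inj Cp o k Cp_complex oCp
            (face_indicator k.+1 R C)).
  - move=> F nF; rewrite /face_indicator; case CF: (F \in _) => //.
    by rewrite (subsetP subC) in nF.
  - move=> F CpF; rewrite /face_indicator; case CF: (F \in faces C k.+1).
      rewrite mulr1; apply: coboundary_boundary_transversal => //.
      exact: (proj2 C_part).
    rewrite mulr0; apply: coboundary_boundary_not_transversal => //.
    apply: added_not_one; by rewrite inE CF.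
  - by exists F0; rewrite /face_indicator CF0 oner_neq0.
  rewrite pnatr_eq0 (bigD1 ord0) //= -lt0n ltn_addr //.
  by case: (C_reg ord0).
have max_eq : max_facet_nbhd k.+1 Cp = (\sum_i d i)%N.
  (* The upper bound, applied to the eigenvalue just found, gives one half. *)
  apply/eqP; rewrite eqn_leq; apply/andP; split; last first.
    by have := ub _ _ _ eig; rewrite ler_nat.
  apply/bigop.bigmax_leqP => F CpF; have [CF | nCF] := boolP (F \in faces C k.+1).
    exact: (facet_nbhd_transversal P_part C_part C_reg).
  by apply: added_small; rewrite inE nCF.
by split=> //; split; [rewrite max_eq | move=> b; exact: ub].
Qed.

Theorem theorem5p2 (R : realType) (r : nat) (hr : (1 <= r)%N) :
  (forall (V : finType) (P : 'I_r.+1 -> {set V}) (C Cp : {set {set V}})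
          (d : 'I_r.+1 -> nat) (o : {set V} -> seq V),
     vertex_partition P -> partite P C -> semiregular P C d ->
     Fplus_of P C d Cp -> orientation Cp o ->
     is_lambda_max (up_laplacian R o Cp r.-1) (max_facet_nbhd r Cp)%:R /\
     max_facet_nbhd r Cp = (\sum_(i < r.+1) d i)%N) /\
  (forall (V : finType) (K : {set {set V}}) (o : {set V} -> seq V),
     Fplus r K -> orientation K o ->
     is_lambda_max (up_laplacian R o K r.-1) (max_facet_nbhd r K)%:R).
Proof.
case: r hr => // k _; split=> [V P C Cp d o | V K o [P [C [d [? ? ? ?]]]] ?].
  exact: Fplus_lambda_max.
exact: (proj1 (@Fplus_lambda_max R V k P C K d o _ _ _ _ _)).
Qed.
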